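(* Let $a$ be a nonzero integer and let $n$ be a positive integer with $n\ge 2$. Then $$\begin{aligned} E_{2n,a}&\equiv\frac{2(1+(-1)^n)a^2-4a}{5a^2-10a+4}+\big(-125a^4+250a^3(-1)^n+250a^2(-1)^n+250a((-1)^n-1)\big)n^3\\&\quad+\big((150(-1)^n+100)a^7+300a^6+(275(-1)^n-25)a^4-25a^3(-1)^n-25a^2(-1)^n-125a(1+(-1)^n)\big)n^2\\&\quad+\big((-200(-1)^n-300)a^7+(25-200(-1)^n)a^6-(275(-1)^n+100)a^5+(30(-1)^n+105)a^4\\&\qquad+270a^3(-1)^n-290a^2(-1)^n+250a((-1)^n-1)\big)n\pmod{5^{\mathrm{ord}_5 n+4}}.\end{aligned}$$
   Context: For a real number $a$, the sequence $\{E_{n,a}\}$ is defined by $E_{0,a}=1$ and $E_{n,a}=-a\sum_{k=1}^{\lfloor n/2\rfloor}\binom{n}{2k}E_{n-2k,a}$ for $n\ge 1$. For a prime $p$ and a positive integer $n$, $\mathrm{ord}_p n$ denotes the largest nonnegative integer $\alpha$ with $p^\alpha\mid n$. A congruence between rational numbers whose denominators are coprime to $p$ is understood modulo the given power of $p$ in the ring of such rationals (here $5a^2-10a+4\equiv 4\pmod 5$ is coprime to $5$). *)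

(* Defs.v *)
From mathcomp Require Import all_boot all_order all_algebra.

Set Implicit Arguments.
Unset Strict Implicit.
Unset Printing Implicit Defensive.

Import Order.TTheory GRing.Theory Num.Theory.
Local Open Scope ring_scope.

(* The course-of-values recursion defining E is run on the list of all previous
   values: E_upto a n = [:: E_{0,a}; ...; E_{n,a}].  Lemmas E_0 and E_rec below
   are the defining equations.  The recurrence only involves ring operations, so
   it makes sense for a in any ring. *)
Fixpoint E_upto (R : pzRingType) (a : R) (n : nat) : seq R :=
  if n is m.+1 then
    rcons (E_upto a m)
      (- a * \sum_(1 <= k < n./2.+1)
               'C(n, 2 * k)%:R * nth 0 (E_upto a m) (n - 2 * k))
  else [:: 1].

Definition E (R : pzRingType) (a : R) (n : nat) : R := nth 0 (E_upto a n) n.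

Lemma size_E_upto (R : pzRingType) (a : R) n : size (E_upto a n) = n.+1.
Proof. by elim: n => //= n IHn; rewrite size_rcons IHn. Qed.

Lemma nth_E_upto (R : pzRingType) (a : R) n i :
  (i <= n)%N -> nth 0 (E_upto a n) i = E a i.
Proof.
elim: n => [|n IHn]; first by rewrite leqn0 => /eqP->.
rewrite leq_eqVlt => /predU1P[-> //|lt_in].
by rewrite /= nth_rcons size_E_upto lt_in IHn.
Qed.

Lemma E_0 (R : pzRingType) (a : R) : E a 0 = 1.
Proof. by []. Qed.

Lemma E_rec (R : pzRingType) (a : R) n : (1 <= n)%N ->
  E a n = - a * \sum_(1 <= k < n./2.+1) 'C(n, 2 * k)%:R * E a (n - 2 * k).
Proof.
case: n => // n _; rewrite {1}/E /= nth_rcons size_E_upto ltnn eqxx.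
congr (_ * _); apply: eq_big_nat => k /andP[k_gt0 _].
by rewrite nth_E_upto // leq_subLR -addn1 addnC leq_add2r muln_gt0.
Qed.

Definition p_integral (p : nat) (x : rat) : Prop := coprimez p%:Z (denq x).

Definition cong_loc (p m : nat) (x y : rat) : Prop :=
  [/\ p_integral p x, p_integral p y
    & exists2 z : rat, p_integral p z & x - y = (p ^ m)%:R * z].

(* Main.v *)
(** [E_{n,a}] is the value at [x^n] of the linear functional on polynomials with
    [(1 - a) f(x) + (a/2) (f(x+1) + f(x-1)) |-> f(0)].  For [a = -2b] this is
    [f |-> \sum_j b^j (delta^j f)(0)], [delta] being the second central
    difference, so it makes sense for every integer-valued function and respects
    congruences between values.  Let [psi] be the Legendre symbol modulo 5 and
    write [psi(x) x^2 = 1 + 5 r(x)] for [x] prime to 5.  Modulo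
    [5^(ord n + 4)] one has
    [x^(2n) = psi(x)^n \sum_(k < 4) C(n, k) 5^k r(x)^k] for all integers [x].
    Applying the functional, the term [k = 0] gives the rational part of the
    theorem exactly, since [delta] acts on even 5-periodic functions through a
    3x3 matrix whose resolvent is explicit.  The other terms, minus the claimed
    polynomial part, have the form [n W(n)] with [6 W] a quadratic polynomial
    depending only on the parity of [n].  It remains to see that [W(n)] vanishes
    modulo 625, and by Lagrange interpolation this follows from the cases
    [n = 2, 4, 6] (or [3, 7, 9]), which are prime to 5 and pairwise incongruent
    modulo 5 and are checked directly. *)
Require Import Defs.
From mathcomp Require Import all_boot all_order all_algebra.
From mathcomp Require Import zify ring.

Import Order.TTheory GRing.Theory Num.Theory.
Local Open Scope ring_scope.

(** * The functional *)

(** This lets the rational sequence of the theorem be studied over the integers, where divisibility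
    makes sense. *)
Lemma rmorph_E (R S : pzRingType) (f : {rmorphism R -> S}) a n :
  f (E a n) = E (f a) n.
Proof.
have [k] := ubnP n; elim: k n => // k IHk [|n] nk.
  by rewrite !E_0 rmorph1.
rewrite !E_rec // rmorphM rmorph_sum rmorphN /=; congr (_ * _).
rewrite big_nat_cond [RHS]big_nat_cond; apply: eq_bigr => i.
by move=> /andP[/andP[i_gt0 _] _]; rewrite rmorphM rmorph_nat IHk //; lia.
Qed.

Section UmbralFunctional.
Context {R : comNzRingType}.
Implicit Types (a b c x : R) (f g : R -> R).

Definition delta f x : R := f (x + 1) + f (x - 1) - 2 * f x.

(** The sum of [b ^+ j * iter j delta f 0] over [j <= J]. Truncation keeps it defined on arbitrary
    functions, in particular periodic ones, for which the full series need not terminate. *)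
Fixpoint umbral b (J : nat) f : R :=
  if J is J'.+1 then f 0 + b * umbral b J' (delta f) else f 0.

Lemma eq_umbral b J f g : f =1 g -> umbral b J f = umbral b J g.
Proof.
elim: J f g => [|J IHJ] f g fg /=; rewrite fg //; congr (_ + _ * _).
by apply: IHJ => x; rewrite /delta !fg.
Qed.

Lemma umbral_sum b J (I : Type) (r : seq I) (c : I -> R) (F : I -> R -> R) :
  umbral b J (fun x => \sum_(i <- r) c i * F i x)
  = \sum_(i <- r) c i * umbral b J (F i).
Proof.
elim: J F => [//|J IHJ] F /=.
rewrite (_ : umbral b J _
  = umbral b J (fun x => \sum_(i <- r) c i * delta (F i) x)).
  rewrite (IHJ (fun i => delta (F i))) mulr_sumr -big_split /=.
  by apply: eq_bigr => i _; ring.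
apply: eq_umbral => x; rewrite /delta -big_split mulr_sumr -sumrB /=.
by apply: eq_bigr => i _; ring.
Qed.

Lemma eq_iter_delta k f g : f =1 g -> iter k delta f =1 iter k delta g.
Proof. by elim: k f g => //= k IHk f g fg x; rewrite /delta !(IHk f g). Qed.

Lemma iter_delta_scale k c f :
  iter k delta (fun x => c * f x) =1 (fun x => c * iter k delta f x).
Proof. by elim: k => //= k IHk x; rewrite /delta !IHk; ring. Qed.

Lemma umbral_scale b J c f : umbral b J (fun x => c * f x) = c * umbral b J f.
Proof.
have := umbral_sum b J _ [:: tt] (fun=> c) (fun=> f); rewrite big_seq1 => <-.
by apply: eq_umbral => x; rewrite big_seq1.
Qed.

(** The geometric series in [b * delta] telescopes against [1 - b * delta]; the last term is the
    truncation error. *)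
Lemma umbral_resolvent b J g :
  umbral b J (fun x => g x - b * delta g x)
  = g 0 - b ^+ J.+1 * iter J.+1 delta g 0.
Proof.
elim: J g => [|J IHJ] g; first by rewrite expr1.
rewrite [LHS]/= (eq_umbral _ _ _ (fun x => delta g x - b * delta (delta g) x)).
  by rewrite IHJ -iterSr (exprS b J.+1); ring.
by move=> x; rewrite /delta; ring.
Qed.

Lemma sum_even_terms (F : nat -> R) m :
  \sum_(0 <= i < m) (1 + (-1) ^+ i) * F i
  = 2 * \sum_(0 <= k < uphalf m) F (2 * k)%N.
Proof.
elim: m => [|m IHm]; first by rewrite !big_geq ?mulr0.
rewrite big_nat_recr //= IHm -signr_odd; case: (boolP (odd m)) => m_odd.
  by rewrite subrr mul0r addr0 uphalf_half m_odd.
rewrite uphalf_half (negPf m_odd) big_nat_recr //= mulrDr.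
by rewrite mul2n even_halfK.
Qed.

Lemma delta_expr n x :
  delta (fun y => y ^+ n) x
  = \sum_(1 <= k < n./2.+1) (2 * 'C(n, 2 * k)%:R) * x ^+ (n - 2 * k).
Proof.
have := sum_even_terms (fun i => 'C(n, i)%:R * x ^+ (n - i)) n.+1.
rewrite /= [in RHS]big_ltn // mulrDr muln0 bin0 subn0 mul1r.
rewrite mulr_sumr; under [in RHS]eq_bigr do rewrite mulrA.
move=> /eqP; rewrite addrC -subr_eq => /eqP <-; rewrite /delta !exprDn.
rewrite -big_split big_mkord /=; congr (_ - _); apply: eq_bigr => i _.
by rewrite expr1n; ring.
Qed.

(** By [delta_expr], applying [delta] once to a power reproduces the recurrence for [-a = 2 * b].
    Each [delta] lowers the degree by at least two, so [J] rounds suffice. *)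
Lemma E_umbral b n J : (n <= 2 * J)%N ->
  E (-2 * b) n = umbral b J (fun x => x ^+ n).
Proof.
elim: J n => [|J IHJ] [|n] // nJ.
  rewrite E_0 /= (eq_umbral _ _ _ (fun x => \sum_(i <- [::]) (i : R) * x)).
    by rewrite (umbral_sum _ _ _ _ id (fun=> id)) big_nil mulr0 addr0.
  by move=> x; rewrite big_nil /delta !expr0; ring.
rewrite E_rec //= expr0n add0r (eq_umbral _ _ _ _ (delta_expr n.+1)).
rewrite (umbral_sum _ _ _ _ _ (fun k x => x ^+ (n.+1 - 2 * k))) !mulr_sumr.
rewrite [LHS]big_nat_cond [RHS]big_nat_cond; apply: eq_bigr => k.
rewrite andbT => /andP[k_gt0 _]; rewrite IHJ; first by ring.
lia.
Qed.

Lemma E_even_rec (a : R) n :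
  E a (2 * n.+1)
  = - a * \sum_(k < n.+1) 'C(2 * n.+1, 2 * k.+1)%:R * E a (2 * (n - k)).
Proof.
rewrite E_rec; last lia.
rewrite mul2n doubleK big_add1 /= big_mkord; congr (_ * _).
by apply: eq_bigr => k _; rewrite -!mul2n -mulnBr subSS.
Qed.

End UmbralFunctional.

Lemma umbral_cong (m b : int) J f g :
  (forall x, m %| f x - g x)%Z -> (m %| umbral b J f - umbral b J g)%Z.
Proof.
elim: J f g => [|J IHJ] f g fg /=; first exact: fg.
rewrite opprD addrACA -mulrBr; apply: rpredD; first exact: fg.
apply: dvdz_mull; apply: IHJ => x.
have -> : delta f x - delta g x =
    (f (x + 1) - g (x + 1)) + (f (x - 1) - g (x - 1)) - 2 * (f x - g x).
  by rewrite /delta; ring.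
by apply: rpredB; [apply: rpredD; exact: fg | apply: dvdz_mull; exact: fg].
Qed.

(** Needed for odd [a], which is of the form [-2 * b] only modulo a power of 5. *)
Lemma E_cong (m a a' : int) n :
  (m %| a - a')%Z -> (m %| E a n - E a' n)%Z.
Proof.
move=> m_aa'; have [k] := ubnP n; elim: k n => // k IHk [|n] nk.
  by rewrite !E_0 subrr dvdz0.
rewrite !E_rec //.
set s := \sum_(_ <= _ < _) _; set s' := \sum_(_ <= _ < _) _.
rewrite (_ : _ - _ = - s * (a - a') - a' * (s - s')); last by ring.
apply: rpredB; apply: dvdz_mull => //; rewrite -sumrB big_nat_cond.
apply: rpred_sum => i /andP[/andP[i_gt0 _] _]; rewrite -mulrBr.
by apply: dvdz_mull; apply: IHk; lia.
Qed.

(** * Even functions of period 5 *)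

(** The values at 0, at 1 and -1, and at 2 and -2 modulo 5 are [u], [v], [w]. *)
Definition periodic5 (u v w x : int) : int :=
  nth 0 [:: u; v; w; w; v] `|(x %% 5)%Z|.

Lemma delta_periodic5 u v w :
  delta (periodic5 u v w) =1 periodic5 (2 * v - 2 * u) (u + w - 2 * v) (v - w).
Proof.
move=> x; rewrite /delta /periodic5 -(modzDml x 1) -(modzDml x (- 1)).
have := modz_ge0 x (isT : 5 != 0 :> int).
have := ltz_pmod x (isT : 0 < 5 :> int).
case: (x %% 5)%Z => // -[|[|[|[|[|]]]]] // _ _.
all: rewrite /=; ring.
Qed.

(* On even 5-periodic functions, delta^3 = -5 (delta^2 + delta). *)
Lemma iter_delta_periodic5 u v w i x :
  (5 ^+ i %| iter i.*2.+1 delta (periodic5 u v w) x)%Z.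
Proof.
elim: i u v w x => [|i IHi] u v w x; first by rewrite expr0 dvd1z.
(* The values of [-(delta f + f)] for [f = periodic5 u v w]. *)
pose u' := - ((2 * v - 2 * u) + u); pose v' := - ((u + w - 2 * v) + v).
pose w' := - ((v - w) + w).
have cube : delta (delta (delta (periodic5 u v w))) =1
    fun y => 5 * delta (periodic5 u' v' w') y.
  move=> y; rewrite -[LHS]/(iter 2 delta (delta (periodic5 u v w)) y).
  rewrite (eq_iter_delta _ _ _ (delta_periodic5 u v w)).
  rewrite -[LHS]/(iter 1 delta (delta (periodic5 _ _ _)) y).
  rewrite (eq_iter_delta _ _ _ (delta_periodic5 _ _ _)) /= !delta_periodic5.
  rewrite /periodic5 /u' /v' /w'.
  by case: `|_|%N => [|[|[|[|[|k]]]]]; rewrite /= ?nth_nil; ring.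
rewrite doubleS (_ : i.*2.+3 = i.*2 + 3)%N; last by rewrite addn3.
rewrite iterD (eq_iter_delta _ _ _ cube) iter_delta_scale exprS.
by rewrite dvdz_mul // -iterSr IHi.
Qed.

(* [psi ((-1) ^+ n)] is the [n]-th power of the Legendre symbol modulo 5. *)
Definition psi (s : int) : int -> int := periodic5 0 1 s.

(* The function [g] in the proof is [1 + 5 b + 5 b^2] times the preimage of
   [psi s] under [1 - b delta], which is invertible up to that determinant. *)
Lemma umbral_psi b s i :
  (5 ^+ i %| (1 + 5 * b + 5 * b ^+ 2) * umbral b i.*2 (psi s)
             - (2 * b + 2 * (1 + s) * b ^+ 2))%Z.
Proof.
pose g := periodic5 (2 * b + 2 * (1 + s) * b ^+ 2)
  ((1 + 2 * b) * (1 + (1 + s) * b))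
  (s + (1 + 4 * s) * b + 2 * (1 + s) * b ^+ 2).
rewrite -umbral_scale (eq_umbral _ _ _ (fun x => g x - b * delta g x));
  last first.
  move=> x; rewrite delta_periodic5 /psi /g /periodic5.
  case: `|_|%N => [|[|[|[|[|k]]]]]; rewrite /= ?nth_nil; ring.
(* [g 0] is exactly the subtracted quadratic in [b], so only the truncation error, of odd order
   [2 * i + 1], remains. *)
rewrite umbral_resolvent addrC addKr -rpredN opprK.
by apply: dvdz_mull; apply: iter_delta_periodic5.
Qed.

(** * Expansion of even powers *)

Variant psi_spec (x s : int) : int -> Type :=
  | PsiZero of (5 %| x)%Z : psi_spec x s 0
  | PsiSquare of (5 %| x ^+ 2 - 1)%Z : psi_spec x s 1
  | PsiNonsquare of (5 %| - x ^+ 2 - 1)%Z : psi_spec x s s.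

Lemma psiP x s : psi_spec x s (psi s x).
Proof.
rewrite /psi /periodic5; have x5 := divz_eq x 5.
have := modz_ge0 x (isT : 5 != 0 :> int).
have := ltz_pmod x (isT : 0 < 5 :> int).
case: (x %% 5)%Z x5 => // -[|[|[|[|[|]]]]] // x5 _ _; constructor; lia.
Qed.

(* A junk value when 5 divides [x], where [psi s x = 0] anyway. *)
Definition psi_quot (x : int) : int := ((psi (- 1) x * x ^+ 2 - 1) %/ 5)%Z.

Lemma psi_quotP x : ~~ (5 %| x)%Z -> psi (- 1) x * x ^+ 2 = 1 + 5 * psi_quot x.
Proof.
rewrite /psi_quot; case: (psiP x (- 1)) => [-> //|h|h] _.
  by rewrite mul1r; lia.
by rewrite mulN1r; lia.
Qed.

(** From [k * 'C(n, k) = n * 'C(n.-1, k.-1)], the binomial loses at most [logn 5 k] factors 5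
    against [n], and [logn 5 k + 4 <= k] once [k >= 4]. *)
Lemma dvdn_exp5_bin n k : (0 < n)%N -> (4 <= k)%N ->
  (5 ^ (logn 5 n + 4) %| 'C(n, k) * 5 ^ k)%N.
Proof.
case: n => // n _; case: k => // k k_ge4.
have [lt_nk|le_kn] := ltnP n k; first by rewrite bin_small ?mul0n ?dvdn0.
have logk : (logn 5 k.+1 + 4 <= k.+1)%N.
  have: (5 ^ logn 5 k.+1 <= k.+1)%N by rewrite dvdn_leq // pfactor_dvdnn.
  case: (logn 5 k.+1) => [|e]; first lia.
  have : (e.+1 + 4 <= 5 ^ e.+1)%N.
    by elim: e => // e; rewrite (expnS 5 e.+1); lia.
  lia.
have C_gt0 : (0 < 'C(n.+1, k.+1))%N by rewrite bin_gt0.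
rewrite pfactor_dvdn // ?muln_gt0 ?C_gt0 ?expn_gt0 //.
rewrite lognM ?expn_gt0 // pfactorK //.
have := congr1 (logn 5) (mul_bin_diag n.+1 k).
rewrite !lognM ?bin_gt0 //; lia.
Qed.

Lemma dvdz_exp5_expr x n : (5 %| x)%Z -> (2 <= n)%N ->
  (5 ^+ (logn 5 n + 4) %| x ^+ (2 * n))%Z.
Proof.
move=> x5 n_ge2; apply: (@dvdz_trans (5 ^+ (2 * n))); last exact: dvdz_exp2r.
apply: dvdz_exp2l.
have: (5 ^ logn 5 n <= n)%N by rewrite dvdn_leq ?pfactor_dvdnn //; lia.
case: (logn 5 n) => [|e]; first lia.
have : (e.+1 + 4 <= 2 * 5 ^ e.+1)%N.
  by elim: e => // e; rewrite (expnS 5 e.+1); lia.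
lia.
Qed.

Lemma psi_sqr x s : ~~ (5 %| x)%Z -> s * s = 1 -> psi s x * psi s x = 1.
Proof. by case: psiP => [->|_ _ _|_ _ ->]. Qed.

Lemma psi_exp x n : (0 < n)%N -> psi (- 1) x ^+ n = psi ((-1) ^+ n) x.
Proof.
move=> n_gt0; rewrite /psi /periodic5; case: `|_|%N => [|[|[|[|[|k]]]]] /=.
all: rewrite ?nth_nil ?expr1n ?expr0n //; lia.
Qed.

Lemma expr_binomial (x : int) n : (2 <= n)%N ->
  (5 ^+ (logn 5 n + 4) %| x ^+ (2 * n)
   - \sum_(k < 4) ('C(n, k)%:R * 5 ^+ k)
       * (psi ((-1) ^+ n) x * psi_quot x ^+ k))%Z.
Proof.
move=> n_ge2; have n_gt0 : (0 < n)%N by lia.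
rewrite -psi_exp //.
have [x5|x5] := boolP (5 %| x)%Z.
  rewrite big1 ?subr0 ?dvdz_exp5_expr // => k _.
  suff -> : psi (- 1) x = 0 by rewrite expr0n (gtn_eqF n_gt0) mul0r mulr0.
  case: psiP => // h; lia.
have -> : x ^+ (2 * n) = psi (- 1) x ^+ n * (1 + 5 * psi_quot x) ^+ n.
  by rewrite -psi_quotP // -exprMn mulrA psi_sqr // mul1r exprM.
pose F k : int := 'C(n, k)%:R * 5 ^+ k * (psi (- 1) x ^+ n * psi_quot x ^+ k).
(* Padding the binomial sum with zero terms up to [n.+4] allows a split at 4 even when [n < 3]. *)
have -> : psi (- 1) x ^+ n * (1 + 5 * psi_quot x) ^+ n
    = \sum_(0 <= k < n.+4) F k.
  rewrite (@big_cat_nat _ _ _ n.+1) //=; last lia.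
  rewrite [X in _ = _ + X]big_nat_cond [X in _ = _ + X]big1 ?addr0.
    rewrite big_mkord exprDn mulr_sumr; apply: eq_bigr => k _.
    by rewrite /F expr1n exprMn; ring.
  by move=> k /andP[/andP[lt_nk _] _]; rewrite /F bin_small // !mul0r.
rewrite -(big_mkord xpredT F) (@big_cat_nat _ _ _ 4) //.
rewrite addrC addKr big_nat_cond.
apply: rpred_sum => k /andP[/andP[k_ge4 _] _]; apply: dvdz_mulr.
have := dvdn_exp5_bin n k n_gt0 k_ge4.
by rewrite dvdzE abszM !abszX (natz 'C(n, k)).
Qed.

Definition moment (s b : int) (J k : nat) : int :=
  umbral b J (fun x => psi s x * psi_quot x ^+ k).

Lemma E_expansion (b : int) n J : (2 <= n <= J)%N ->
  (5 ^+ (logn 5 n + 4) %| E (-2 * b) (2 * n)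
   - \sum_(k < 4) ('C(n, k)%:R * 5 ^+ k) * moment ((-1) ^+ n) b J k)%Z.
Proof.
move=> /andP[n_ge2 n_leJ]; rewrite (E_umbral _ _ J) ?leq_mul2l //.
rewrite -(umbral_sum b J 'I_4 _ _
  (fun k x => psi ((-1) ^+ n) x * psi_quot x ^+ k)).
by apply: umbral_cong => x; apply: expr_binomial.
Qed.

(** * The cases n = 2, 3, 4, 6, 7, 9 *)

Section Coefs.
Context {R : comNzRingType}.
Implicit Types s a : R.

Definition num0 s a := 2 * (1 + s) * a ^+ 2 - 4 * a.
Definition den0 a := 5 * a ^+ 2 - 10 * a + 4.
Definition cubic_coef s a :=
  - 125 * a ^+ 4 + 250 * a ^+ 3 * s + 250 * a ^+ 2 * s
  + 250 * a * (s - 1).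
Definition quadratic_coef s a :=
  (150 * s + 100) * a ^+ 7 + 300 * a ^+ 6
  + (275 * s - 25) * a ^+ 4 - 25 * a ^+ 3 * s - 25 * a ^+ 2 * s
  - 125 * a * (1 + s).
Definition linear_coef s a :=
  (- 200 * s - 300) * a ^+ 7 + (25 - 200 * s) * a ^+ 6
  - (275 * s + 100) * a ^+ 5 + (30 * s + 105) * a ^+ 4
  + 270 * a ^+ 3 * s - 290 * a ^+ 2 * s + 250 * a * (s - 1).
Definition poly_part s a (x : R) :=
  cubic_coef s a * x ^+ 3 + quadratic_coef s a * x ^+ 2 + linear_coef s a * x.

End Coefs.

(* The product of five consecutive integers is divisible by 5, so [125] times it
   vanishes modulo 625 although it is not zero as a polynomial modulo 625. *)
Lemma dvdz625_prod5 (a x y z : int) :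
  x = 625 * z + 125 * y * (a * (a - 1) * (a - 2) * (a - 3) * (a - 4)) ->
  (625 %| x)%Z.
Proof.
have /dvdzP[t ->] : (5 %| a * (a - 1) * (a - 2) * (a - 3) * (a - 4))%Z.
  have: [|| 5 %| a, 5 %| a - 1, 5 %| a - 2, 5 %| a - 3 | 5 %| a - 4]%Z by lia.
  by case/or4P => [h|h|h|/orP[h|h]]; do 4?[exact: dvdz_mull | apply: dvdz_mulr].
by move=> ->; apply/dvdzP; exists (z + y * t); ring.
Qed.

Lemma exists_dvd (m x q : int) : (m %| x - q)%Z -> exists z, x = q + m * z.
Proof. by case/dvdzP=> z zE; exists z; rewrite mulrC -zE; ring. Qed.

Ltac eval_binomials :=
  repeat match goal with |- context [binomial ?n ?k] =>
    let q := eval vm_compute in ('C(n, k) %/ 625)%N in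
    let r := eval vm_compute in ('C(n, k) %% 625)%N in
    rewrite (_ : 'C(n, k) = q * 625 + r)%N; [|by []]
  end.

Ltac E_mod_step a n :=
  apply: exists_dvd; rewrite (E_even_rec a n) !big_ord_recr big_ord0 /= ?E_0;
  eval_binomials;
  repeat match goal with Ea : E a _ = _ |- _ => rewrite {}Ea end; lia.

Local Arguments E : simpl never.
Local Arguments binomial : simpl never.

Lemma base_cases (a : int) (m : nat) : m \in [:: 2; 3; 4; 6; 7; 9]%N ->
  (625 %| den0 a * (E a (2 * m) - poly_part ((-1) ^+ m) a m%:R)
          - num0 ((-1) ^+ m) a)%Z.
Proof.
(* The coefficients are those of [E_{2n,a}] reduced modulo 625. *)
have [z1 E1] : exists z, E a 2 = a * (-1) + 625 * z.
  E_mod_step a 0%N.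
have [z2 E2] : exists z, E a 4 = a * (-1 + a * 6) + 625 * z.
  E_mod_step a 1%N.
have [z3 E3] : exists z, E a 6 = a * (-1 + a * (30 + a * (-90))) + 625 * z.
  E_mod_step a 2%N.
have [z4 E4] : exists z, E a 8 = a * (-1 + a * (126 + a * (-10 + a * 20))) +
  625 * z.
  E_mod_step a 3%N.
have [z5 E5] : exists z, E a 10 = a * (-1 + a * (-115 + a * (-105 + a * (-25 +
  a * (-275))))) + 625 * z.
  E_mod_step a 4%N.
have [z6 E6] : exists z, E a 12 = a * (-1 + a * (171 + a * (155 + a * (40 + a
  * (-125 + a * 25))))) + 625 * z.
  E_mod_step a 5%N.
have [z7 E7] : exists z, E a 14 = a * (-1 + a * (65 + a * (80 + a * (50 + a *
  (75 + a * (-225 + a * 225)))))) + 625 * z.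
  E_mod_step a 6%N.
have [z8 E8] : exists z, E a 16 = a * (-1 + a * (266 + a * (-255 + a * (-190 +
  a * (250 + a * (75 + a * (250 + a * (-125)))))))) + 625 * z.
  E_mod_step a 7%N.
have [z9 E9] : exists z, E a 18 = a * (-1 + a * (-180 + a * (-35 + a * (-275 +
  a * (-200 + a * (-50 + a * (-200 + a * (125 + a * (-250))))))))) + 625 * z.
  E_mod_step a 8%N.
rewrite /poly_part /cubic_coef /quadratic_coef /linear_coef /num0.
rewrite !inE => /or4P[|||/or3P[]] /eqP ->; rewrite -signr_odd /= ?expr1 ?expr0.
(* In each case the claim is a polynomial in [a] vanishing modulo 625 as a function; the first
   witness multiplies 125 times the five consecutive integers, the second multiplies 625. *)
- apply: (dvdz625_prod5 a _ (-2 + a * (2 + a * (-2 + a * 1))) (a * (16 + a *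
    (-54 + a * (57 + a * (-16 + a * (18 + a * (-31 + a * (22 + a * (-7))))))))
    + den0 a * z2)).
  by rewrite E2 /den0; ring.
- apply: (dvdz625_prod5 a _ (a * (-2 + a * (-2))) (a * (96 + a * (-194 + a *
    (65 + a * (-39 + a * (-29 + a * (30 + a * (55 + a * (-39 + a * 6)))))))) +
    den0 a * z3)).
  by rewrite E3 /den0; ring.
- apply: (dvdz625_prod5 a _ (2 + a * (-2 + a * (-1 + a * 1))) (a * (16 + a *
    (-126 + a * (125 + a * (178 + a * (-167 + a * (-31 + a * (67 + a * (-1 + a
    * (-16))))))))) + den0 a * z4)).
  by rewrite E4 /den0; ring.
- apply: (dvdz625_prod5 a _ (2 + a * (-2 + a * (1 + a * 1))) (a * (48 + a *
    (-442 + a * (503 + a * (597 + a * (-700 + a * (37 + a * (136 + a * (18 + a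
    * (-48))))))))) + den0 a * z6)).
  by rewrite E6 /den0; ring.
- apply: (dvdz625_prod5 a _ (a * (-2 + a * 2)) (a * (1120 + a * (-2262 + a *
    (603 + a * (-324 + a * (-247 + a * (374 + a * (276 + a * (-186 + a *
    27)))))))) + den0 a * z7)).
  by rewrite E7 /den0; ring.
- apply: (dvdz625_prod5 a _ (2 + a * (2 + a * (1 + a * (-1 + a * 2)))) (a *
    (2352 + a * (-4758 + a * (1283 + a * (-765 + a * (-405 + a * (804 + a *
    (422 + a * (-282 + a * (34 + a * (5 + a * (-2))))))))))) + den0 a * z9)).
  by rewrite E9 /den0; ring.
Qed.

(** * Interpolation in n *)

Lemma coprimez_exp5 k x : ~~ (5 %| x)%Z -> coprimez (5 ^+ k) x.
Proof. by move=> x5; rewrite coprimezXl // coprimezE prime_coprime. Qed.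

(** Lagrange interpolation with denominators cleared: the differences of the nodes are units modulo
    5. *)
Lemma lagrange5 k (w : int -> int) (w0 w1 w2 : int) x0 x1 x2 n :
  w =1 (fun x => w0 + w1 * x + w2 * x ^+ 2) ->
  ~~ (5 %| x0 - x1)%Z -> ~~ (5 %| x0 - x2)%Z -> ~~ (5 %| x1 - x2)%Z ->
  (5 ^+ k %| w x0)%Z -> (5 ^+ k %| w x1)%Z -> (5 ^+ k %| w x2)%Z ->
  (5 ^+ k %| w n)%Z.
Proof.
move=> wE d01 d02 d12 h0 h1 h2.
rewrite -(Gauss_dvdzr _ (coprimez_exp5 k _ d01)).
rewrite -(Gauss_dvdzr _ (coprimez_exp5 k _ d02)).
rewrite -(Gauss_dvdzr _ (coprimez_exp5 k _ d12)).
rewrite (_ : _ * _ = (x1 - x2) * (n - x1) * (n - x2) * w x0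
  - (x0 - x2) * (n - x0) * (n - x2) * w x1
  + (x0 - x1) * (n - x0) * (n - x1) * w x2); last by rewrite !wE; ring.
by apply: rpredD; [apply: rpredB|]; apply: dvdz_mull.
Qed.

(** The factor 6 clears the denominators of ['C(n, 2)] and ['C(n, 3)], and [den0 a] that of the
    rational part. *)
Lemma E_quadratic (a b s : int) (n M i : nat) (l := moment s b i.*2) :
  (2 <= n <= i.*2)%N -> (-1) ^+ n = s ->
  (logn 5 n + 4 <= M <= i)%N -> (5 ^+ M %| a + 2 * b)%Z ->
  (5 ^+ (logn 5 n + 4) %| 6 * (den0 a * E a (2 * n) - num0 s a)
    - den0 a * (n%:R * (30 * l 1%N + 75 * (n%:R - 1) * l 2%N
                        + 125 * (n%:R - 1) * (n%:R - 2) * l 3%N)))%Z.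
Proof.
move=> n_bounds sE /andP[le_nM le_Mi] ab; set P := 5 ^+ _.
have Pab : (P %| a - -2 * b)%Z.
  by rewrite mulNr opprK (dvdz_trans _ ab) // dvdz_exp2l.
have EaEb := E_cong _ _ _ (2 * n) Pab.
have := E_expansion b _ _ n_bounds; rewrite sE -/P.
set S := \sum_(k < 4) _ => EbS.
have l0 : (P %| (1 + 5 * b + 5 * b ^+ 2) * l 0%N
                - (2 * b + 2 * (1 + s) * b ^+ 2))%Z.
  rewrite /l /moment (eq_umbral _ _ _ (psi s)); last first.
    by move=> x; rewrite expr0 mulr1.
  by apply: dvdz_trans (umbral_psi b s i); apply/dvdz_exp2l/(leq_trans le_nM).
have SE : 6 * S = 6 * l 0%N + n%:R * (30 * l 1%N + 75 * (n%:R - 1) * l 2%N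
                        + 125 * (n%:R - 1) * (n%:R - 2) * l 3%N).
  have n_gt0 : (0 < n)%N by lia.
  have n1 : n.-1%:R = n%:R - 1 :> int by rewrite -subn1 natrB.
  have n2 : n.-2%:R = n%:R - 2 :> int by rewrite -subn2 natrB //; lia.
  have C2 : 2 * 'C(n, 2)%:R = n%:R * (n%:R - 1) :> int.
    by rewrite -n1 -!natrM -mul_bin_diag bin1.
  have C3 : 6 * 'C(n, 3)%:R = n%:R * (n%:R - 1) * (n%:R - 2) :> int.
    rewrite -n1 -n2 -!natrM (_ : 6 = 2 * 3)%N // -mulnA -mul_bin_diag.
    by rewrite mulnCA -mul_bin_diag bin1 mulnA.
  rewrite /S !big_ord_recr big_ord0 /= bin0 bin1 -/l.
  transitivity (6 * l 0%N + 30 * n%:R * l 1%N + 75 * (2 * 'C(n, 2)%:R) * l 2%N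
    + 125 * (6 * 'C(n, 3)%:R) * l 3%N); first by ring.
  by rewrite C2 C3; ring.
(* Passes from [a] to [-2 * b] and from [E] to its expansion. At [-2 * b], [den0] and [num0] are 4
   times the expressions in [l0], whence the factor 24. *)
rewrite (_ : _ - _ = 6 * den0 a * (E a (2 * n) - E (-2 * b) (2 * n))
  + 6 * den0 a * (E (-2 * b) (2 * n) - S)
  + (6 * (5 * (a - 2 * b) - 10) * l 0%N
     - 6 * (2 * (1 + s) * (a - 2 * b) - 4)) * (a - -2 * b)
  + 24 * ((1 + 5 * b + 5 * b ^+ 2) * l 0%N
          - (2 * b + 2 * (1 + s) * b ^+ 2))
  + den0 a * (6 * S - (6 * l 0%N
      + n%:R * (30 * l 1%N + 75 * (n%:R - 1) * l 2%N
                + 125 * (n%:R - 1) * (n%:R - 2) * l 3%N)))); last first.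
  by rewrite /den0 /num0; ring.
rewrite SE subrr mulr0 addr0.
by do 3?apply: rpredD; apply: dvdz_mull.
Qed.

Lemma E_even_congruence (a : int) (n : nat) : (2 <= n)%N ->
  (5 ^+ (logn 5 n + 4) %| den0 a * (E a (2 * n) - poly_part ((-1) ^+ n) a n%:R)
                         - num0 ((-1) ^+ n) a)%Z.
Proof.
move=> n_ge2; set s := (-1) ^+ n; set M := (logn 5 n + 4)%N.
(* As [5 ^+ M] is odd, [b = a * h] gives [a + 2 * b = a * 5 ^+ M]. *)
have [h hE] : exists h : int, 5 ^+ M = 2 * h + 1.
  elim: M => [|M [h hE]]; first by exists 0.
  by exists (5 * h + 2); rewrite exprS hE; ring.
pose b := a * h; have ab : (5 ^+ M %| a + 2 * b)%Z.
  by apply/dvdzP; exists a; rewrite hE /b; ring.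
(* One truncation length serves [n] and all sample points up to 9, so they share the moments [l] and
   the quadratic polynomial [w]. *)
pose i := (n + 9 + M)%N; pose l := moment s b i.*2.
pose w (x : int) := den0 a * (30 * l 1%N + 75 * (x - 1) * l 2%N
    + 125 * (x - 1) * (x - 2) * l 3%N)
  - 6 * den0 a * (cubic_coef s a * x ^+ 2 + quadratic_coef s a * x
                  + linear_coef s a).
have wE : w =1 fun x =>
    den0 a * (30 * l 1%N - 75 * l 2%N + 250 * l 3%N - 6 * linear_coef s a)
    + den0 a * (75 * l 2%N - 375 * l 3%N - 6 * quadratic_coef s a) * x
    + den0 a * (125 * l 3%N - 6 * cubic_coef s a) * x ^+ 2.
  by move=> x; rewrite /w; ring.
have Ew m : (2 <= m <= i.*2)%N -> (-1) ^+ m = s ->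
    (logn 5 m + 4 <= M <= i)%N ->
    (5 ^+ (logn 5 m + 4)
      %| 6 * (den0 a * (E a (2 * m) - poly_part s a m%:R) - num0 s a)
         - m%:R * w m%:R)%Z.
  move=> m_bounds ms mM; have := E_quadratic _ _ _ _ _ _ m_bounds ms mM ab.
  by congr (_ %| _)%Z; rewrite /w /poly_part; ring.
have base m : m \in [:: 2; 3; 4; 6; 7; 9]%N -> (-1) ^+ m = s ->
    (5 ^+ 4 %| w m%:R)%Z.
  move=> m_in ms; have m5 : ~~ (5 %| m)%N.
    by move: m_in; rewrite !inE => /or4P[|||/or3P[]] /eqP ->.
  have m_bounds : (2 <= m <= 9)%N.
    by move: m_in; rewrite !inE => /or4P[|||/or3P[]] /eqP ->.
  have logm : logn 5 m = 0%N by rewrite lognE (negPf m5) !andbF.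
  have := Ew m; rewrite logm ms => /(_ _ erefl _) dvd_w.
  have : (5 ^+ 4 %| m%:R * w m%:R)%Z.
    rewrite -(@rpredBr _ _
      (6 * (den0 a * (E a (2 * m) - poly_part s a m%:R) - num0 s a))).
      by rewrite -opprB rpredN dvd_w //; lia.
    by apply: dvdz_mull; rewrite -ms; apply: base_cases.
  by rewrite (Gauss_dvdzr _ (coprimez_exp5 4 m%:R _)) // natz.
have wn : (5 ^+ 4 %| w n%:R)%Z.
  have [n_odd|n_even] := boolP (odd n).
    have sE : s = -1 by rewrite /s -signr_odd n_odd.
    by apply: (lagrange5 4 _ _ _ _ 3%:R 7%:R 9%:R n%:R wE) => //; apply: base.
  have sE : s = 1 by rewrite /s -signr_odd (negPf n_even).
  by apply: (lagrange5 4 _ _ _ _ 2%:R 4%:R 6%:R n%:R wE) => //; apply: base.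
(* After multiplication by the unit 6, the error [n%:R * w n%:R] gets [logn 5 n] factors 5 from [n]
   and four from [w]. *)
rewrite -(Gauss_dvdzr _ (coprimez_exp5 M 6 isT)).
rewrite -[X in (_ %| X)%Z](subrK (n%:R * w n%:R)); apply: rpredD.
  by apply: (Ew n) => //; rewrite /i; lia.
rewrite /M exprD; apply: dvdz_mul => //.
by rewrite dvdzE abszX (natz n); exact: pfactor_dvdnn.
Qed.

(** * Passage from integer divisibility to congruences of rationals *)

Lemma p_integral_frac (p : nat) (u d : int) :
  coprimez p d -> p_integral p (u%:~R / d%:~R).
Proof.
rewrite /p_integral => pd; set x := u%:~R / d%:~R.
(* For [d = 0] the quotient is 0 by convention, with denominator 1. *)
have [d0|d_neq0] := eqVneq d 0.
  by rewrite /x d0 invr0 mulr0 (denq_int 0) coprimezE coprimen1.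
suff dvd_den : (denq x %| d)%Z.
  by move: pd; rewrite !coprimezE; apply: coprime_dvdr.
have cross : numq x * d = u * denq x.
  apply/eqP; rewrite -(eqr_int rat) !rmorphM /= numqE mulrAC.
  by rewrite /x divfK // intr_eq0.
rewrite -(@Gauss_dvdzr _ (numq x)); first by rewrite cross dvdz_mull.
by rewrite coprimez_sym coprimezE coprime_num_den.
Qed.

Theorem theorem5p1 (a : int) (n : nat) (ha : a != 0) (hn : (2 <= n)%N) :
  let A : rat := a%:~R in
  let N : rat := n%:R in
  let s : rat := (-1) ^+ n in
  cong_loc 5 (logn 5 n + 4) (E A (2 * n))
    ((2 * (1 + s) * A ^+ 2 - 4 * A) / (5 * A ^+ 2 - 10 * A + 4)
     + (- 125 * A ^+ 4 + 250 * A ^+ 3 * s + 250 * A ^+ 2 * s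
        + 250 * A * (s - 1)) * N ^+ 3
     + ((150 * s + 100) * A ^+ 7 + 300 * A ^+ 6 + (275 * s - 25) * A ^+ 4
        - 25 * A ^+ 3 * s - 25 * A ^+ 2 * s - 125 * A * (1 + s)) * N ^+ 2
     + ((- 200 * s - 300) * A ^+ 7 + (25 - 200 * s) * A ^+ 6
        - (275 * s + 100) * A ^+ 5 + (30 * s + 105) * A ^+ 4
        + 270 * A ^+ 3 * s - 290 * A ^+ 2 * s + 250 * A * (s - 1)) * N).
Proof.
move=> A N s.
set X := E A _; set Y := _ + _.
have XE : X = (E a (2 * n))%:~R by rewrite /X -rmorph_E.
have d5 : coprimez 5 (den0 a).
  by rewrite -[5]expr1 coprimez_exp5 // /den0; lia.
have d_neq0 : (den0 a)%:~R != 0 :> rat.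
  rewrite intr_eq0; apply: contraTneq d5 => ->.
  by rewrite coprimezE.
have YE : Y = (num0 ((-1) ^+ n) a + den0 a * poly_part ((-1) ^+ n) a n%:R)%:~R
              / (den0 a)%:~R.
  have sE : s = ((-1) ^+ n)%:~R by rewrite rmorphXn rmorphN1.
  have denE : 5 * A ^+ 2 - 10 * A + 4 = (den0 a)%:~R by rewrite /den0 /A; ring.
  rewrite rmorphD rmorphM mulrDl (mulrC (den0 a)%:~R) mulfK //.
  rewrite /Y denE -2!addrA.
  congr (_ / _ + _).
    by rewrite sE /A /num0; ring.
  rewrite sE /A /N /poly_part /cubic_coef /quadratic_coef /linear_coef.
  ring.
have [z zE] := dvdzP (E_even_congruence a n hn).
split.
- by rewrite XE -[_%:~R]divr1; apply: (p_integral_frac 5 _ 1).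
- by rewrite YE; apply: p_integral_frac.
exists (z%:~R / (den0 a)%:~R); first exact: p_integral_frac.
rewrite XE YE; apply: (mulIf d_neq0).
rewrite mulrBl divfK // -mulrA divfK // natrX.
have -> : 5 ^+ (logn 5 n + 4) * z%:~R = (z * 5 ^+ (logn 5 n + 4))%:~R :> rat.
  by rewrite rmorphM rmorphXn mulrC.
by rewrite -zE; ring.
Qed.
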